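(* Let $r\ge 2$, let $d\ge 2$ be an integer, and let $f:S^1\to S^1$ be a $C^r$ orientation preserving expanding endomorphism of degree $d$. Then $f$ is $C^r$ conjugated to $E_d$ if and only if the Lyapunov exponent of $f$ is constant on the set $\mathrm{Per}(f)$ of periodic points of $f$, i.e. $\lambda_f(p)=\lambda_f(q)$ for all $p,q\in \mathrm{Per}(f)$.
   Context: $S^1=\mathbb{R}/\mathbb{Z}$. A $C^1$ map $f:S^1\to S^1$ is expanding if there is $\lambda>1$ with $|Df(z)|>\lambda$ for every $z\in S^1$ (for a suitable Riemannian metric). $E_d:S^1\to S^1$ is the linear map $E_d(x)=dx \pmod 1$. ''$f$ is $C^r$ conjugated to $E_d$'' means there is a $C^r$ diffeomorphism $h:S^1\to S^1$ with $f\circ h=h\circ E_d$. For a periodic point $p$ with $f^n(p)=p$, $n\ge1$, its Lyapunov exponent is $\lambda_f(p)=\frac1n\log|Df^n(p)|$. *)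

(* Defs.v *)
From HB Require Import structures.
From mathcomp Require Import all_boot all_order all_algebra.
From mathcomp Require Import all_classical all_reals all_analysis.
From mathcomp Require Import lra.

Set Implicit Arguments.
Unset Strict Implicit.
Unset Printing Implicit Defensive.

Import Order.TTheory GRing.Theory Num.Theory.
Import numFieldNormedType.Exports.

Local Open Scope quotient_scope.
Local Open Scope classical_set_scope.
Local Open Scope ring_scope.

(* The subgroup Z of R; [Num.int_num_subdef] is the predicate underlying the
   qualifier [Num.int]. *)
Definition Zsubgroup (R : realType) : zmodClosed R :=
  GRing.ZmodClosed.clone R (@Num.int_num_subdef R) _.

Definition circle (R : realType) : zmodType := Quotient.quot (Zsubgroup R).

Definition circle_pi (R : realType) (x : R) : circle R :=
  \pi_(Quotient.quot (Zsubgroup R)) x.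

Definition circle_repr (R : realType) (z : circle R) : R :=
  repr (z : Quotient.quot (Zsubgroup R)).

Lemma circle_reprK (R : realType) : cancel (@circle_repr R) (@circle_pi R).
Proof. by move=> z; rewrite /circle_pi /circle_repr reprK. Qed.

Lemma circle_pi_eq (R : realType) (x y : R) :
  (circle_pi x == circle_pi y) = (x - y \is a Num.int).
Proof. by rewrite /circle_pi -Quotient.idealrBE. Qed.

Definition is_lift (R : realType) (f : circle R -> circle R) (F : R -> R) :=
  continuous F /\ forall x, f (circle_pi x) = circle_pi (F x).

Definition Ck (R : realType) (k : nat) (F : R -> R) :=
  (forall j, (j < k)%N -> forall x, derivable (derive1n j F) x 1)
  /\ continuous (derive1n k F).

(* For real r >= 0 with integer part k: class C^k, and, when r is not an
   integer, k-th derivative Hoelder continuous with exponent r - k.  The global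
   Hoelder bound agrees with the local one for the functions of interest, whose
   k-th derivative is 1-periodic (lifts, k >= 1). *)
Definition Cr (R : realType) (r : R) (F : R -> R) :=
  let k := Num.truncn r in
  Ck k F /\
  (k%:R < r -> exists C : R, forall x y : R,
    `|derive1n k F x - derive1n k F y| <= C * `|x - y| `^ (r - k%:R)).

(* R is the universal cover of the circle and [circle_pi] a local
   diffeomorphism, so a map of the circle is of class C^r iff it has a C^r
   lift. *)
Definition circle_Cr (R : realType) (r : R) (f : circle R -> circle R) :=
  exists2 F, is_lift f F & Cr r F.

Definition has_degree (R : realType) (f : circle R -> circle R) (d : int) :=
  exists2 F, is_lift f F & forall x, F (x + 1) = F x + d%:~R.

(* Independent of the chosen lift, see [Df_lift]; the value is irrelevant for
   maps without lift, i.e. discontinuous ones. *)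
Definition Df (R : realType) (f : circle R -> circle R) (z : circle R) : R :=
  derive1 (xget (fun=> 0) [set F | is_lift f F]) (circle_repr z).

Lemma int_valued_cst (R : realType) (D : R -> R) :
  continuous D -> (forall x, D x \is a Num.int) -> forall x y, D x = D y.
Proof.
move=> Dc Dint; suff H x y : x <= y -> D x = D y.
  by move=> x y; case/orP: (le_total x y) => ?; [exact: H|symmetry; exact: H].
move=> xy; apply/eqP/negPn/negP => Dxy.
have Zgap (a b : R) : a \is a Num.int -> b \is a Num.int -> a < b -> a + 1 <= b.
  move=> /intrP[m ->] /intrP[n ->]; rewrite ltr_int -[1]/(1%:~R) -intrD ler_int.
  by rewrite lezD1.
pose m := Num.min (D x) (D y).
have mZ : m \is a Num.int by rewrite /m; case: leP.
have mM : m + 1 <= Num.max (D x) (D y).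
  apply: Zgap => //; first by case: leP.
  by move: Dxy; rewrite neq_lt /m; case: ltgtP.
have [c _ Dc2] : exists2 c, c \in `[x, y] & D c = m + 2^-1.
  apply: IVT => //; first exact: continuous_subspaceT.
  by apply/andP; split; move: mM; rewrite /m; lra.
have := Zgap _ _ mZ (Dint c); rewrite Dc2 => /(_ _); lra.
Qed.

Lemma lift_unique (R : realType) (f : circle R -> circle R) F G :
  is_lift f F -> is_lift f G -> exists m : int, forall x, G x = F x + m%:~R.
Proof.
move=> [Fc Ff] [Gc Gf].
have Dint x : G x - F x \is a Num.int by rewrite -circle_pi_eq -Gf Ff.
have Dc : continuous (fun x => G x - F x).
  by move=> x; apply: cvgB; [exact: Gc|exact: Fc].
have /intrP[m Em] := Dint 0; exists m => x.
by rewrite -Em (int_valued_cst Dc Dint 0 x) addrC subrK.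
Qed.

Lemma Df_lift (R : realType) (f : circle R -> circle R) F (x : R) :
  is_lift f F -> Df f (circle_pi x) = derive1 F x.
Proof.
move=> Ff; rewrite /Df; set G := xget _ _.
have Gf : is_lift f G by rewrite /G; apply: xgetPex; exists F.
have [n En] : exists n : int, circle_repr (circle_pi x) = x + n%:~R.
  have : circle_repr (circle_pi x) - x \is a Num.int by rewrite -circle_pi_eq circle_reprK.
  by move=> /intrP[n En]; exists n; rewrite -En addrC subrK.
have Gn : is_lift f (fun y => G (y + n%:~R)).
  case: Gf => Gc Gf; split.
    move=> y; have := @continuous_comp R R R (fun y => y + n%:~R) G y.
    apply; last exact: Gc.
    by apply: cvgD; [exact: cvg_id|exact: cvg_cst].
  move=> y; rewrite -Gf; congr f; apply/eqP; rewrite circle_pi_eq opprD addrA subrr add0r.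
  by rewrite rpredN; exact: intr_int.
have [m Em] := lift_unique Gn Ff.
have -> : F = fun y => G (y + n%:~R) + m%:~R by apply/funext.
rewrite En /derive1; set u := (X in lim (X @ _)); set v := (X in _ = lim (X @ _)).
suff -> : u = v by [].
apply/funext => h; rewrite /u /v; congr (_ *: _).
by rewrite addrA opprD addrACA subrr addr0.
Qed.

Definition orientation_preserving (R : realType) (f : circle R -> circle R) :=
  forall z, 0 < Df f z.

(* In the coordinate given by [circle_pi], a Riemannian metric is g(z) dz^2
   with g positive and smooth. *)
Definition riemannian_metric (R : realType) (g : circle R -> R) :=
  (forall z, 0 < g z) /\ forall k, Ck k (g \o @circle_pi R).

Definition metric_norm (R : realType) (g : circle R -> R) (z : circle R)
    (v : R) : R :=
  Num.sqrt (g z) * `|v|.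

(* Operator norm of Df(z), computed on the unit coordinate vector. *)
Definition expanding (R : realType) (f : circle R -> circle R) :=
  circle_Cr 1 f /\
  exists2 g, riemannian_metric g &
  exists2 lambda : R, 1 < lambda & forall z,
    lambda < metric_norm g (f z) (Df f z) / metric_norm g z 1.

Definition linear_map (R : realType) (d : int) (z : circle R) : circle R :=
  z *~ d.

Definition circle_Cr_diffeo (R : realType) (r : R)
    (h : circle R -> circle R) :=
  circle_Cr r h /\
  exists k, [/\ cancel h k, cancel k h & circle_Cr r k].

Definition Cr_conjugate (R : realType) (r : R) (f g : circle R -> circle R) :=
  exists2 h, circle_Cr_diffeo r h & forall z, f (h z) = h (g z).

Definition is_period (R : realType) (f : circle R -> circle R) (n : nat)
    (p : circle R) :=
  (1 <= n)%N /\ iter n f p = p.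

(* Exponent of p computed along the period n; by the chain rule it does not
   depend on the period chosen. *)
Definition lyapunov (R : realType) (f : circle R -> circle R) (n : nat)
    (p : circle R) : R :=
  n%:R^-1 * ln `|Df (iter n f) p|.

(* Main.v *)
Require Import Defs.
From HB Require Import structures.
From mathcomp Require Import all_boot all_order all_algebra.
From mathcomp Require Import all_classical all_reals all_analysis.
From mathcomp Require Import ring lra.
Import Order.TTheory GRing.Theory Num.Theory.
Import numFieldNormedType.Exports.
Set Implicit Arguments.
Unset Strict Implicit.
Unset Printing Implicit Defensive.
Local Open Scope classical_set_scope.
Local Open Scope ring_scope.

(** Write F for a lift of f to the line, so that F (x + 1) = F x + d.

    A conjugacy forces the exponents (conjugate_lyapunov).  Differentiating
    F^n (H x) = H (d^n x) + m at a point x over a periodic point of E_d, the two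
    factors H' cancel, because they are values of the derivative of h at one
    and the same point of the circle, and (F^n)' = d^n is left: every exponent
    is ln d.

    Conversely, let the exponents all equal ln c.  On the line F is an
    expanding diffeomorphism with a fixed point p, so G = F^-1 contracts the
    line to p.  The series u = sum_k (ln c - ln F' o G^(k+1)) therefore
    converges, locally uniformly, to a continuous solution of
      u (F x) = u x + ln c - ln F' x                      (transfer_function).
    Nothing so far relates u to the circle; the hypothesis on the exponents
    shows that u is 1-periodic.  If F^n y = y + m, then y covers a point of
    period n, so (F^n)' y = c^n and the equation gives u (y + m) = u y.  Such
    y exist for every n, and tend to p by expansion; hence u (p + m) = u p
    (u_fixed_point).  If now F^n z = p + m, then, (F^n)' being periodic,
    u (z + j) - u z = u (p + m + d^n j) - u (p + m) = 0, and these z are dense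
    (u_periodic).  So the primitive of exp u that vanishes at p, which
    linearizes F because of the equation for u, commutes with integer
    translations up to a factor: after rescaling it is a C^1 diffeomorphism
    phi with phi (x + 1) = phi x + 1 and phi (F x) = d phi x
    (linearizing_chart).

    It remains to raise the regularity of psi = phi^-1, the lift of the
    conjugacy, from C^1 to C^r.  Differentiating psi t = F (psi (t / d)) and
    taking logarithms, v = ln psi' satisfies
      v t = v (t / d) + ln F' (psi (t / d)) - ln d.
    A continuous solution of v t = b t + c v (t / d) with |c| <= 1 is as
    regular as b (smooth_scaling_solution), for each differentiation divides c
    by d > 1.  Hence if psi is of class C^j with j <= r - 1, then so is v, and
    psi is of class C^(j+1); the inverse phi is treated in the same way from
    phi' = 1 / (psi' o phi) (smooth_conjugacy). *)

(** * Calculus on the line *)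

Section Calculus.
Variable R : realType.
Implicit Types (f g : R -> R) (x y a b c : R).

Lemma is_derive_derive1 f x a : is_derive x 1 f a -> derive1 f x = a.
Proof. by move=> fa; rewrite derive1E derive_val. Qed.

Lemma is_derive_continuous_at f x a : is_derive x 1 f a -> {for x, continuous f}.
Proof. by move=> [fx _]; exact/differentiable_continuous/derivable1_diffP. Qed.

Lemma is_derive_continuous f g :
  (forall x, is_derive x 1 f (g x)) -> continuous f.
Proof. by move=> fg x; exact: is_derive_continuous_at (fg x). Qed.

Lemma is_derive_scale c x : is_derive x 1 (fun t : R => t * c) c.
Proof.
by apply: is_derive_eq (_ : x *: 0 + c *: 1 = c); rewrite scaler0 add0r -[LHS]/(c * 1) mulr1.
Qed.

Lemma is_derive_comp_scale f a c x : is_derive (x * c) 1 f a ->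
  is_derive x 1 (fun t => f (t * c)) (a * c).
Proof. by move=> fa; have := is_derive_scale c x; exact: is_derive1_comp. Qed.

Lemma is_derive_translate f a c x : is_derive (x + c) 1 f a ->
  is_derive x 1 (fun t => f (t + c)) a.
Proof.
move=> fa; have := is_derive_shift x 1 c => D.
by rewrite -[a]mulr1; exact: (@is_derive1_comp R f (shift c) x a 1 fa D).
Qed.

Lemma continuous_translate f c : continuous f -> continuous (fun x => f (x + c)).
Proof.
move=> fc x; apply: (@continuous_comp _ _ _ (shift c) f); last exact: fc.
by apply: cvgD; [exact: cvg_id|exact: cvg_cst].
Qed.

Lemma is_derive_mulr f a c x : is_derive x 1 f a ->
  is_derive x 1 (fun t => f t * c) (a * c).
Proof.
move=> fa; apply: is_derive_eq (_ : f x *: 0 + c *: a = a * c).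
by rewrite scaler0 add0r mulrC.
Qed.

Lemma is_derive_unique f x a b : is_derive x 1 f a -> is_derive x 1 f b -> a = b.
Proof. by move=> /is_derive_derive1 <- /is_derive_derive1 <-. Qed.

Lemma mean_value_on f g a b :
  (forall x, Num.min a b <= x <= Num.max a b -> is_derive x 1 f (g x)) ->
  exists2 c, Num.min a b <= c <= Num.max a b & f b - f a = g c * (b - a).
Proof.
wlog ab : a b / a <= b => [H fg|].
  have [ab|ba] := orP (le_total a b); first exact: (H _ _ ab).
  have [|c cba E] := H _ _ ba; first by move=> x; rewrite minC maxC; exact: fg.
  exists c; first by rewrite minC maxC.
  by rewrite -[LHS]opprB E -mulrN opprB.
rewrite min_l// max_r// => fg.
have [x||c] := @MVT_segment _ f g a b ab.
- by rewrite in_itv/= => /andP[ax xb]; apply: fg; rewrite !ltW.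
- apply: continuous_in_subspaceT => x; rewrite inE/= in_itv/= => xab.
  exact: is_derive_continuous_at (fg x xab).
- by rewrite in_itv/= => cab E; exists c.
Qed.

Lemma mean_value f g a b : (forall x, is_derive x 1 f (g x)) ->
  exists2 c, Num.min a b <= c <= Num.max a b & f b - f a = g c * (b - a).
Proof. by move=> fg; exact: mean_value_on. Qed.

Lemma eq_of_derive f g h x0 : (forall x, is_derive x 1 f (h x)) ->
  (forall x, is_derive x 1 g (h x)) -> f x0 = g x0 -> f =1 g.
Proof.
move=> fh gh E x; apply/eqP; rewrite -subr_eq0; apply/eqP.
have D y : is_derive y 1 (f - g) 0 by apply: is_derive_eq (subrr (h y)).
by rewrite -[LHS]/((f - g) x) (is_derive_0_is_cst x x0 D) /= -[LHS]/(f x0 - g x0) E subrr.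
Qed.

Lemma continuous_bounded_on f M : continuous f ->
  exists C, forall x, `|x| <= M -> `|f x| <= C.
Proof.
move=> fc; have [M0|M0] := ltP M 0.
  by exists 0 => x xM; have := le_lt_trans xM M0; rewrite normr_lt0.
have [||c _ Hc] := @EVT_max _ (fun x => `|f x|) (- M) M; first lra.
  apply: continuous_subspaceT => x; apply: cvg_norm; exact: fc.
by exists `|f c| => x; rewrite ler_norml => xM; apply: Hc; rewrite in_itv.
Qed.

Lemma periodic_int f : (forall x, f (x + 1) = f x) ->
  forall x (m : int), f (x + m%:~R) = f x.
Proof.
move=> fp x m; have nat_case y (n : nat) : f (y + n%:R) = f y.
  by elim: n => [|n IH]; rewrite ?addr0// -natr1 addrA fp.
case: m => n; first exact: nat_case.
by rewrite NegzE mulrNz -[in RHS](subrK n.+1%:R x) nat_case.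
Qed.

Lemma int_near x : exists m : int, 0 <= x + m%:~R <= 1.
Proof.
exists (- Num.floor x); have := floor_itv x.
rewrite mulrNz mulrzDr => /andP[]; lra.
Qed.

Lemma periodic_bounded f : continuous f -> (forall x, f (x + 1) = f x) ->
  exists C, forall x, `|f x| <= C.
Proof.
move=> fc fp; have [C HC] := continuous_bounded_on 1 fc; exists C => x.
have [m xm] := int_near x; rewrite -(periodic_int fp x m); apply: HC.
by rewrite ger0_norm; lra.
Qed.

Lemma periodic_lower_bound f : continuous f -> (forall x, f (x + 1) = f x) ->
  (forall x, 0 < f x) -> exists2 c, 0 < c & forall x, c <= f x.
Proof.
move=> fc fp f0; have [|c _ Hc] := @EVT_min _ f 0 1 ler01.
  exact: continuous_subspaceT.
exists (f c) => // x; have [m xm] := int_near x.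
by rewrite -(periodic_int fp x m); apply: Hc; rewrite in_itv.
Qed.

Lemma IVT_between f a b v : continuous f ->
  Num.min (f a) (f b) <= v <= Num.max (f a) (f b) ->
  exists2 c, Num.min a b <= c <= Num.max a b & f c = v.
Proof.
move=> fc; wlog ab : a b / a <= b => [H|vab].
  have [ab|ba] := orP (le_total a b); first exact: (H _ _ ab).
  by rewrite minC maxC => /(H _ _ ba)[c]; exists c; rewrite // minC maxC.
have [|c] := @IVT _ f a b v ab _ vab; first exact: continuous_subspaceT.
by rewrite in_itv/= => cab E; exists c; rewrite ?min_l ?max_r.
Qed.

End Calculus.

Section Antiderivative.
Variable R : realType.
Notation mu := (@lebesgue_measure R).

(** The integral from a base point on the left of x is differentiable at x.  No
    single base point serves for all x, so it moves with x; integrals from two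
    base points differ by a constant, which is removed by subtracting the value
    at 0. *)
Lemma antiderivative (g : R -> R) : continuous g ->
  exists f : R -> R, forall x : R, is_derive x 1 f (g x).
Proof.
move=> gc; pose I (a x : R) := (\int[mu]_(t in `[a, x]) g t)%R.
have gint a b : mu.-integrable `[a, b] (EFin \o g).
  apply: continuous_compact_integrable; first exact: segment_compact.
  exact: continuous_subspaceT.
have dI (a x : R) : a < x -> is_derive x 1 (I a) (g x).
  move=> ax; have [||D E] := @continuous_FTC1_closed _ g a x (x + 1) _ (gint _ _) ax.
  - lra.
  - exact: gc.
  by apply: DeriveDef => //; rewrite -derive1E.
have IB a b x y : a <= b -> b <= x -> b <= y -> I a x - I a y = I b x - I b y.
  move=> ab bx bY.
  have H z : b <= z -> I a z = I a b + I b z.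
    move=> bz; rewrite -[I a z](subrK (I a b)) addrC; congr (_ + _).
    rewrite /I Rintegral_itvB ?bnd_simp//.
    by rewrite Rintegral_itv_obnd_cbnd//; apply: integrableS (gint b z) => //; exact: subset_itv_oc_cc.
  by rewrite (H x)// (H y)//; ring.
pose f x := I (Num.min x 0 - 1) x - I (Num.min x 0 - 1) 0.
(* one fixed base point serves for all x at distance less than 1 from x0 *)
exists f => x0; set a := Num.min x0 0 - 2.
have D : is_derive x0 1 (fun x => I a x - I a 0) (g x0).
  have ax : a < x0 by rewrite /a; case: (leP x0 0) => ?; lra.
  have := @is_deriveB _ _ _ (I a) (cst (I a 0)) x0 1 _ _ (dI a x0 ax) (is_derive_cst _ _ _).
  by rewrite subr0.
apply: near_eq_is_derive D.
near=> x; rewrite /f.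
have : `|x0 - x| < 1 by near: x; exact: (@nbhsx_ballx _ R x0 1 ltr01).
rewrite ltr_norml => /andP[? ?].
by apply: IB; rewrite /a; case: (leP x0 0) => ?; case: (leP x 0) => ?; lra.
Unshelve. all: by end_near. Qed.

End Antiderivative.

(** * Twisted cohomological equations *)

Section Cocycle.
Variable R : realType.

Lemma iter_continuous (T : R -> R) k : continuous T -> continuous (iter k T).
Proof.
move=> Tc; elim: k => [|k IH] x /=; first exact: cvg_id.
by apply: continuous_comp; [exact: IH|exact: Tc].
Qed.

Lemma small_geometric (A q e : R) : 0 <= q < 1 -> 0 < e ->
  exists n, A * q ^+ n < e.
Proof.
move=> /andP[q0 q1] e0.
have /cvgr0_norm_lt/(_ e e0)[n _ Hn] :=
  @cvg_geometric R A q ltac:(by rewrite ger0_norm).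
by exists n; apply: le_lt_trans (Hn n _) => /=; [exact: ler_norm|exact: leqnn].
Qed.

(** The solution is the series sum_k c^k b (T^k x).  The geometric bound is asked
    for on bounded sets only, which is what a map contracting the line to a
    point provides; it gives locally uniform convergence, hence continuity. *)
Lemma cocycle_solution (T b : R -> R) (c q : R) :
  continuous T -> continuous b -> 0 <= q < 1 ->
  (forall M, exists A, forall k x, `|x| <= M ->
    `|c ^+ k * b (iter k T x)| <= A * q ^+ k) ->
  exists w, continuous w /\ forall x, w x = b x + c * w (T x).
Proof.
move=> Tc bc /[dup] qq /andP[q0 q1] H.
pose u x k := c ^+ k * b (iter k T x); pose s x := series (u x).
have sc n : continuous (s^~ n).
  elim: n => [|n IH] x.
    have -> : s^~ 0%N = cst 0 by apply/funext => y; rewrite /s /series/= big_geq.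
    exact: cvg_cst.
  have -> : s^~ n.+1 = (fun y => s y n + u y n).
    by apply/funext => y; rewrite /s /series/= big_nat_recr.
  apply: cvgD; first exact: IH.
  apply: cvgM; first exact: cvg_cst.
  apply: continuous_comp; [exact: iter_continuous|exact: bc].
have tail M A : (forall k x, `|x| <= M -> `|u x k| <= A * q ^+ k) ->
    forall x, `|x| <= M -> forall n j,
    `|s x (n + j)%N - s x n| <= A / (1 - q) * q ^+ n.
  move=> HA x xM n j.
  have A0 : 0 <= A by have := HA 0%N x xM; rewrite expr0 mulr1; apply: le_trans.
  have : `|s x (n + j)%N - s x n| <= A / (1 - q) * q ^+ n * (1 - q ^+ j).
    elim: j => [|j IH]; first by rewrite addn0 subrr normr0 expr0 subrr mulr0.
    rewrite addnS {1}/s /series/= big_nat_recr//= -/(series (u x) (n + j)) -/(s x).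
    rewrite addrAC; apply: le_trans (ler_normD _ _) _.
    apply: le_trans (lerD IH (HA _ _ xM)) _.
    rewrite exprD exprS le_eqVlt; apply/orP; left; apply/eqP; field.
    by rewrite subr_eq0 gt_eqF.
  move/le_trans; apply; apply: ler_piMr.
    by rewrite mulr_ge0// ?exprn_ge0// divr_ge0// subr_ge0 ltW.
  by rewrite gerBl exprn_ge0.
have scvg x : cvgn (s x).
  apply: normed_cvg; have [A HA] := H `|x|.
  apply: (@series_le_cvg _ _ (geometric A q)) => [n|n|n|] /=.
  - exact: normr_ge0.
  - by apply: le_trans (HA n x (lexx _)).
  - exact: HA.
  - by apply: is_cvg_geometric_series; rewrite ger0_norm.
pose w x := limn (s x).
have wtail M A : (forall k x, `|x| <= M -> `|u x k| <= A * q ^+ k) ->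
    forall x, `|x| <= M -> forall n, `|w x - s x n| <= A / (1 - q) * q ^+ n.
  move=> HA x xM n.
  have cv : (fun m => `|s x m - s x n|) @ \oo --> `|w x - s x n|.
    by apply: cvg_norm; apply: cvgB; [exact: scvg|exact: cvg_cst].
  rewrite -(cvg_lim _ cv)//; apply: limr_le; first by apply: cvgP cv.
  exists n => // m /= nm; rewrite -(subnKC nm); exact: (tail M A HA).
exists w; split=> x; last first.
  have c1 : (fun n => s x n.+1) @ \oo --> w x by rewrite (cvg_shiftS (s x)); exact: (scvg x).
  have E n : s x n.+1 = b x + c * s (T x) n.
    rewrite /s /series/= big_nat_recl//= /u expr0 mul1r; congr (_ + _).
    by rewrite mulr_sumr; apply: eq_bigr => i _; rewrite exprS mulrA iterSr.
  have c2 : (fun n => b x + c * s (T x) n) @ \oo --> b x + c * w (T x).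
    by apply: cvgD; [exact: cvg_cst|apply: cvgM; [exact: cvg_cst|exact: scvg]].
  rewrite (_ : (fun n => s x n.+1) = (fun n => b x + c * s (T x) n)) in c1; last exact/funext.
  exact: cvg_unique c1 c2.
apply/cvgrPdist_lt => e e0.
have [A HA] := H (`|x| + 1); have {}wtail := wtail _ _ HA.
have [n Hn] := small_geometric (A / (1 - q)) qq (divr_gt0 e0 (ltr0n R 3)).
have e3 : 0 < e / 3 by rewrite divr_gt0.
near=> y.
have xy1 : `|x - y| < 1 by near: y; exact: (@nbhsx_ballx _ R x 1 ltr01).
have sxy : `|s x n - s y n| < e / 3.
  by near: y; have /cvgrPdist_lt := sc n x; apply.
have yM : `|y| <= `|x| + 1.
  rewrite -[y](subKr x); apply: le_trans (ler_normB _ _) _.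
  by rewrite lerD2l ltW.
have Hx := le_lt_trans (wtail x ltac:(by rewrite lerDl) n) Hn.
have Hy := le_lt_trans (wtail y yM n) Hn.
rewrite (_ : w x - w y = (w x - s x n) + (s x n - s y n) - (w y - s y n)); last by ring.
apply: le_lt_trans (ler_normB _ _) _; apply: le_lt_trans (lerD (ler_normD _ _) (lexx _)) _.
lra.
Unshelve. all: by end_near. Qed.

End Cocycle.

(** * Functions of class C^(j + gamma) *)

Section SmoothClass.
Variables (R : realType) (gamma : R).
Hypothesis gamma01 : 0 <= gamma <= 1.
Implicit Types (f g h : R -> R).

(** For gamma = 0 this is mere continuity (continuous_loc_holder), so that
    integral and non-integral regularity are treated at once, with gamma the
    fractional part of r.  The bound is local, unlike the one in Cr, because
    unbounded functions such as lifts must be included. *)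
Definition loc_holder f := continuous f /\ forall M, exists2 C, 0 <= C &
  forall x y, `|x| <= M -> `|y| <= M -> `|f x - f y| <= C * `|x - y| `^ gamma.

Fixpoint smooth (j : nat) f : Prop :=
  if j is i.+1 then exists2 f' : R -> R, (forall x : R, is_derive x 1 f (f' x)) & smooth i f'
  else loc_holder f.

Lemma smooth_continuous j f : smooth j f -> continuous f.
Proof. by case: j => [[]//|j [f' /is_derive_continuous]]. Qed.

(** Lipschitz bounds imply Hoelder bounds on bounded sets. *)
Lemma le_powR_holder (t M : R) : 0 <= t <= M -> t <= (1 + M) * t `^ gamma.
Proof.
move: gamma01 => /andP[g0 g1] /andP[t0 tM].
have [->|tn0] := eqVneq t 0; first by rewrite mulr_ge0 ?powR_ge0//; lra.
have tp : 0 < t by rewrite lt0r tn0.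
have [t1|t1] := leP t 1.
  have : t `^ 1 <= t `^ gamma by apply: ger_powR => //; rewrite tp.
  rewrite powRr1// => H; apply: le_trans H _; apply: ler_peMl; rewrite ?powR_ge0//; lra.
have : t `^ 0 <= t `^ gamma by apply: ler_powR => //; exact: ltW.
rewrite powRr0 => H; apply: (@le_trans _ _ (1 + M)); first lra.
by apply: ler_peMr => //; lra.
Qed.

Lemma C1_locally_lipschitz f f' : (forall x : R, is_derive x 1 f (f' x)) ->
  continuous f' -> forall M, exists2 C, 0 <= C &
  forall x y, `|x| <= M -> `|y| <= M -> `|f x - f y| <= C * `|x - y|.
Proof.
move=> ff' f'c M; have [C HC] := continuous_bounded_on M f'c.
have [M0|M0] := ltP M 0.
  by exists 0 => // x y xM; have := le_lt_trans xM M0; rewrite normr_lt0.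
have C0 : 0 <= C by have := HC 0; rewrite normr0 => /(_ M0); apply: le_trans.
exists C => // x y xM yM; have [c cyx ->] := mean_value y x ff'.
rewrite normrM ler_wpM2r//; apply: HC; move: cyx xM yM.
by rewrite !ler_norml; case: (leP y x) => _; lra.
Qed.

Lemma lipschitz_loc_holder f : continuous f -> (forall M, exists2 C, 0 <= C &
  forall x y, `|x| <= M -> `|y| <= M -> `|f x - f y| <= C * `|x - y|) ->
  loc_holder f.
Proof.
move=> fc fl; split=> // M; have [M0|M0] := ltP M 0.
  by exists 0 => // x y xM; have := le_lt_trans xM M0; rewrite normr_lt0.
have [C C0 HC] := fl M.
exists (C * (1 + (M + M))) => [|x y xM yM]; first by rewrite mulr_ge0//; lra.
apply: le_trans (HC x y xM yM) _; rewrite -mulrA ler_wpM2l//.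
apply: le_powR_holder; rewrite normr_ge0/=.
by apply: le_trans (ler_normB _ _) _; exact: lerD.
Qed.

Lemma continuous_loc_holder f : gamma = 0 -> continuous f -> loc_holder f.
Proof.
move=> g0 fc; split=> // M; have [C HC] := continuous_bounded_on M fc.
exists (`|C| + `|C|) => // x y xM yM.
rewrite g0 powRr0 mulr1; apply: le_trans (ler_normB _ _) _.
by apply: lerD; apply: le_trans (ler_norm C); exact: HC.
Qed.

Lemma smoothW j f : smooth j.+1 f -> smooth j f.
Proof.
elim: j f => [|j IH] f [f' ff' f's]; last by exists f' => //; exact: IH.
apply: lipschitz_loc_holder; first exact: is_derive_continuous ff'.
exact: C1_locally_lipschitz ff' (proj1 f's).
Qed.

Lemma smooth_le i j f : (i <= j)%N -> smooth j f -> smooth i f.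
Proof.
by move=> /subnK <-; elim: (j - i)%N => [//|n IH]; rewrite addSn => /smoothW.
Qed.

Lemma smooth_cst j (c : R) : smooth j (cst c).
Proof.
elim: j c => [|j IH] c; last by exists (cst 0) => // x; exact: is_derive_cst.
apply: lipschitz_loc_holder; first by move=> x; exact: cvg_cst.
by move=> M; exists 0 => // x y _ _; rewrite subrr normr0 mul0r.
Qed.

Lemma smoothD j f g : smooth j f -> smooth j g -> smooth j (fun x => f x + g x).
Proof.
elim: j f g => [|j IH] f g.
  move=> [fc fh] [gc gh]; split=> [x|M]; first by apply: cvgD; [exact: fc|exact: gc].
  have [C C0 HC] := fh M; have [D D0 HD] := gh M.
  exists (C + D) => [|x y xM yM]; first exact: addr_ge0.
  rewrite opprD addrACA mulrDl; apply: le_trans (ler_normD _ _) _.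
  by apply: lerD; [exact: HC|exact: HD].
move=> [f' ff' f's] [g' gg' g's]; exists (fun x => f' x + g' x); last exact: IH.
by move=> x; exact: is_deriveD.
Qed.

Lemma smoothM j f g : smooth j f -> smooth j g -> smooth j (fun x => f x * g x).
Proof.
elim: j f g => [|j IH] f g.
  move=> [fc fh] [gc gh]; split=> [x|M]; first by apply: cvgM; [exact: fc|exact: gc].
  have [C C0 HC] := fh M; have [D D0 HD] := gh M.
  have [A HA] := continuous_bounded_on M fc.
  have [B HB] := continuous_bounded_on M gc.
  exists (C * `|B| + `|A| * D) => [|x y xM yM]; first by rewrite addr_ge0// mulr_ge0.
  rewrite (_ : f x * g x - f y * g y = (f x - f y) * g x + f y * (g x - g y)); last by ring.
  apply: le_trans (ler_normD _ _) _; rewrite !normrM mulrDl.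
  apply: lerD.
    rewrite mulrAC; apply: ler_pM => //; first exact: HC.
    by apply: le_trans (HB x xM) _; exact: ler_norm.
  rewrite -mulrA; apply: ler_pM => //; last exact: HD.
  by apply: le_trans (HA y yM) _; exact: ler_norm.
move=> /[dup] fs [f' ff' f's] /[dup] gs [g' gg' g's].
exists (fun x => f x * g' x + g x * f' x).
  by move=> x; exact: is_deriveM.
by apply: smoothD; apply: IH => //; exact: smoothW.
Qed.

Lemma smooth_comp j f g g' : smooth j f -> smooth j g ->
  (forall x : R, is_derive x 1 g (g' x)) -> continuous g' ->
  smooth j (f \o g).
Proof.
elim: j f g g' => [|j IH] f g g'.
  move=> [fc fh] _ gg' g'c; split=> [x|M].
    by apply: continuous_comp; [exact: is_derive_continuous gg' x|exact: fc].
  have [N HN] := continuous_bounded_on M (is_derive_continuous gg').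
  have [C C0 HC] := fh N; have [K K0 HK] := C1_locally_lipschitz gg' g'c M.
  exists (C * K `^ gamma) => [|x y xM yM]; first by rewrite mulr_ge0// powR_ge0.
  apply: le_trans (HC _ _ (HN _ xM) (HN _ yM)) _.
  rewrite -mulrA ler_wpM2l// -powRM//.
  case/andP: gamma01 => g0 g1.
  by apply: ge0_ler_powR => //; rewrite ?nnegrE ?mulr_ge0//; exact: HK.
move=> [f' ff' f's] /[dup] gs [h gh hs] gg' g'c.
exists (fun x => f' (g x) * h x) => [x|]; first exact: is_derive1_comp.
by apply: smoothM => //; apply: IH g'c => //; exact: smoothW.
Qed.

(** By the intermediate value theorem every point between f x and f y is itself a
    value of f.  So the mean value theorem for h uses h' only on the range of f,
    and the lemma applies to functions, like ln and inversion, that are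
    differentiable only on a part of the line. *)
Lemma smooth0_outer f h h' : loc_holder f ->
  (forall x, is_derive (f x) 1 h (h' (f x))) -> continuous (h' \o f) ->
  loc_holder (h \o f).
Proof.
move=> [fc fh] hh' h'c; split=> [x|M].
  by apply: continuous_comp; [exact: fc|exact: is_derive_continuous_at (hh' x)].
have [C C0 HC] := fh M; have [A HA] := continuous_bounded_on M h'c.
exists (`|A| * C) => [|x y xM yM]; first by rewrite mulr_ge0.
have Hlip : `|h (f x) - h (f y)| <= `|A| * `|f x - f y|.
  have mid z : Num.min (f x) (f y) <= z <= Num.max (f x) (f y) ->
      exists2 c, `|c| <= M & f c = z.
    move=> /(IVT_between fc)[c cxy E]; exists c => //; move: cxy xM yM.
    by rewrite !ler_norml; case: (leP x y) => _; lra.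
  have D z : Num.min (f x) (f y) <= z <= Num.max (f x) (f y) -> is_derive z 1 h (h' z).
    by move=> /mid[c _ <-].
  have [z] := mean_value_on D.
  rewrite distrC => /mid[c cM <-] ->; rewrite normrM distrC ler_wpM2r//.
  by apply: le_trans (HA c cM) _; exact: ler_norm.
rewrite -mulrA; apply: le_trans Hlip _; rewrite ler_wpM2l//; exact: HC.
Qed.

Lemma smooth_inv j f : (forall x, 0 < f x) -> smooth j f ->
  smooth j (fun x => (f x)^-1).
Proof.
move=> f0; have fn0 x : f x != 0 by rewrite gt_eqF.
have D x : is_derive (f x) 1 (@GRing.inv R) (- (f x) ^- 2).
  have := @is_deriveV _ id (f x) 1 1 (fn0 x) (is_derive_id _ _).
  by rewrite -[_ *: _]/(_ * _) mulr1.
elim: j => [fs|j IH].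
  apply: (@smooth0_outer f GRing.inv (fun y => - y ^- 2)) => // x.
  apply: cvgN; apply: cvgV; first by rewrite expf_neq0.
  by apply: cvgM; exact: (proj1 fs).
move=> /[dup] /smoothW fj [f' ff' f's].
exists (fun x => - 1 * ((f x)^-1 * (f x)^-1) * f' x) => [x|].
  have -> : - 1 * ((f x)^-1 * (f x)^-1) = - (f x) ^- 2 by rewrite mulN1r -invfM expr2.
  exact: is_derive1_comp.
apply: smoothM => //; apply: smoothM; first exact: smooth_cst.
by apply: smoothM; exact: IH.
Qed.

Lemma smooth_ln j f : (forall x, 0 < f x) -> smooth j f ->
  smooth j (fun x => ln (f x)).
Proof.
move=> f0; case: j => [fs|j [f' ff' f's]].
  apply: (@smooth0_outer f (@ln R) GRing.inv) => // [x|x].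
    exact: is_derive1_ln.
  by apply: cvgV; [rewrite gt_eqF|exact: (proj1 fs)].
exists (fun x => (f x)^-1 * f' x) => [x|].
  by have := is_derive1_ln (f0 x) => D; exact: is_derive1_comp.
by apply: smoothM => //; apply: smooth_inv => //; apply: smoothW; exists f'.
Qed.

Lemma smooth_expR j f : smooth j f -> smooth j (fun x => expR (f x)).
Proof.
elim: j f => [|j IH] f.
  move=> fs; apply: (@smooth0_outer f (@expR R) (@expR R)) => // x.
  by apply: continuous_comp; [exact: (proj1 fs)|exact: continuous_expR].
move=> /[dup] /smoothW fj [f' ff' f's].
exists (fun x => expR (f x) * f' x) => [x|]; first exact: is_derive1_comp.
by apply: smoothM => //; exact: IH.
Qed.

Lemma smooth_id j : smooth j id.
Proof. by apply: smoothW; exists (cst 1); [move=> x; exact: is_derive_id|exact: smooth_cst]. Qed.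

Lemma smooth_scale j f (c : R) : smooth j f -> smooth j (fun t => f (t * c)).
Proof.
move=> fs; apply: (@smooth_comp j f (fun t => t * c) (cst c)) => //.
- by apply: smoothM; [exact: smooth_id|exact: smooth_cst].
- by move=> x; exact: is_derive_scale.
- by move=> x; exact: cvg_cst.
Qed.

(** * Regularity of solutions of scaling equations *)

(** For j = 0 and gamma > 0, iterating the equation n times bounds the oscillation of v by that
    of v near 0, which tends to 0, plus a geometric series of ratio
    d^(- gamma).  For the induction step, the formally differentiated equation
    w t = b' t + (c / d) w (t / d) is contracting and has a continuous solution
    w.  A primitive V of w solves the original equation up to a constant, and
    v - V is constant because its increments from 0 satisfy the homogeneous
    equation; so v' = w, to which the induction hypothesis applies. *)
Lemma smooth_scaling_solution j (d c : R) (v b : R -> R) :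
  1 < d -> `|c| <= 1 -> continuous v -> smooth j b ->
  (forall t, v t = b t + c * v (t / d)) -> smooth j v.
Proof.
move=> d1; have d0 : 0 < d by lra.
have di : 0 <= d^-1 < 1 by rewrite invr_ge0 (ltW d0) invf_lt1.
have iterE n t : iter n (fun s : R => s / d) t = t * d^-1 ^+ n.
  by elim: n => [|n IH] /=; rewrite ?mulr1// IH exprSr mulrA.
have to0 t : (fun n => t * d^-1 ^+ n) @ \oo --> (0 : R).
  by apply: (@cvg_geometric R t d^-1); rewrite ger0_norm; lra.
elim: j c v b => [|j IH] c v b c1 vc bs vE.
  have [g0|g0] := eqVneq gamma 0; first exact: continuous_loc_holder.
  split=> // M; have [C C0 HC] := proj2 bs M.
  pose q := d^-1 `^ gamma.
  have q1 : 0 <= q < 1.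
    have E1 : 1 `^ gamma = 1 by rewrite powR1.
    rewrite powR_ge0/= -[ltRHS]E1; case/andP: di => di0 di1.
    have gp : 0 < gamma by rewrite lt0r g0; case/andP: gamma01.
    by apply: gt0_ltr_powR; rewrite ?nnegrE.
  (* C' is the fixed point of C' = C + q C', one step of the iteration *)
  pose C' := C / (1 - q); exists C' => [|x y xM yM]; first by rewrite divr_ge0//; lra.
  have main n : `|v x - v y| <= `|v (x * d^-1 ^+ n) - v (y * d^-1 ^+ n)| + C' * `|x - y| `^ gamma.
    elim: n x y xM yM => [|n IHn] x y xM yM.
      by rewrite !expr0 !mulr1 lerDl mulr_ge0 ?powR_ge0// divr_ge0//; lra.
    have Md z : `|z| <= M -> `|z / d| <= M.
      by move=> zM; rewrite normrM (le_trans _ zM)// ler_piMr// ger0_norm; lra.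
    have -> : v x - v y = (b x - b y) + c * (v (x / d) - v (y / d)).
      by rewrite (vE x) (vE y); ring.
    apply: le_trans (ler_normD _ _) _; rewrite normrM.
    have H1 : `|c| * `|v (x / d) - v (y / d)| <= `|v (x / d) - v (y / d)|.
      exact: ler_piMl.
    apply: le_trans (lerD (HC x y xM yM) (le_trans H1 (IHn _ _ (Md _ xM) (Md _ yM)))) _.
    rewrite -mulrBl normrM (@ger0_norm _ d^-1); last by lra.
    rewrite powRM//; last by lra.
    rewrite -!mulrA -!exprS -/q addrCA lerD2l le_eqVlt; apply/orP; left; apply/eqP.
    by rewrite /C'; field; lra.
  have cv : (fun n => `|v (x * d^-1 ^+ n) - v (y * d^-1 ^+ n)| + C' * `|x - y| `^ gamma)
      @ \oo --> `|v 0 - v 0| + C' * `|x - y| `^ gamma.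
    apply: cvgD; last exact: cvg_cst.
    apply: cvg_norm; apply: cvgB; apply: (cvg_comp _ _ (to0 _)); exact: vc.
  rewrite subrr normr0 add0r in cv.
  rewrite -(cvg_lim _ cv)//; apply: limr_ge; first exact: cvgP cv.
  by near=> n; exact: main.
case: bs => b' bb' b's.
have [|||M|w [wc wE]] := @cocycle_solution R (fun t => t / d) b' (c / d) d^-1.
- by move=> t; apply: cvgM; [exact: cvg_id|exact: cvg_cst].
- exact: smooth_continuous b's.
- exact: di.
- have [B HB] := continuous_bounded_on M (smooth_continuous b's).
  exists B => k t tM; rewrite iterE normrM normrX normrM (@ger0_norm _ d^-1); last by lra.
  have B0 : 0 <= B by apply: le_trans (HB t tM).
  have dv0 : 0 <= d^-1 by case/andP: di.
  rewrite [leLHS]mulrC; apply: ler_pM => //.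
  + by rewrite exprn_ge0// mulr_ge0.
  + apply: HB; rewrite normrM (le_trans _ tM)// ler_piMr// ger0_norm ?exprn_ge0//.
    by apply: exprn_ile1; lra.
  + by rewrite lerXn2r ?nnegrE ?mulr_ge0// ler_piMl.
have [V VD] := antiderivative wc.
pose N t := V t - c * V (t / d); pose E t := v t - V t.
have ND (t : R) : is_derive t 1 N (b' t).
  have -> : b' t = w t - c * (w (t / d) * d^-1) by rewrite (wE t); ring.
  apply: is_deriveB; apply: is_deriveZ.
  exact: is_derive_comp_scale.
have NE t : N t = b t + (N 0 - b 0).
  apply: (@eq_of_derive _ N (fun t => b t + (N 0 - b 0)) b' 0) => [s|].
    rewrite -[b' s]addr0; apply: is_deriveD.
  by rewrite addrCA subrr addr0.
have EE t : E t - E 0 = c * (E (t / d) - E 0).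
  have := NE t; have := vE t; have := vE 0; rewrite /N /E mul0r; lra.
have Econt : continuous E.
  by move=> s; apply: cvgB; [exact: vc|exact: is_derive_continuous VD s].
have Ele t n : `|E t - E 0| <= `|E (t * d^-1 ^+ n) - E 0|.
  elim: n => [|n IHn]; first by rewrite expr0 mulr1.
  apply: le_trans IHn _; rewrite EE normrM exprSr mulrA.
  exact: ler_piMl.
have Ec t : E t = E 0.
  have cv : (fun n => `|E (t * d^-1 ^+ n) - E 0|) @ \oo --> `|E 0 - E 0|.
    apply: cvg_norm; apply: cvgB; last exact: cvg_cst.
    by apply: (cvg_comp _ _ (to0 _)); exact: Econt.
  have : `|E t - E 0| <= `|E 0 - E 0|.
    rewrite -(cvg_lim _ cv)//; apply: limr_ge; first exact: cvgP cv.
    by near=> n; exact: Ele.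
  by rewrite subrr normr0 normr_le0 subr_eq0 => /eqP.
exists w; last first.
  apply: (IH (c / d) w b') => //; rewrite normrM (@ger0_norm _ d^-1); last by lra.
  by rewrite -[leRHS]mulr1 ler_pM//; lra.
move=> t; have -> : v = (fun t => V t + E 0).
  by apply/funext => s; rewrite -(Ec s) /E addrC subrK.
by rewrite -[w t]addr0; exact: is_deriveD.
Unshelve. all: by end_near. Qed.

(** * Comparison with iterated derivatives *)

Lemma Ck_smooth k f : (forall i, (i < k)%N -> forall x, derivable (derive1n i f) x 1) ->
  loc_holder (derive1n k f) -> smooth k f.
Proof.
elim: k f => [//|k IH] f fd fk; exists (derive1 f).
  by move=> x; apply: DeriveDef; [exact: (fd 0%N)|rewrite derive1E].
by apply: IH => [i ik|]; rewrite -derive1Sn//; exact: fd.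
Qed.

Lemma smooth_Ck k f : smooth k f ->
  (forall i, (i < k)%N -> forall x, derivable (derive1n i f) x 1) /\
  loc_holder (derive1n k f).
Proof.
elim: k f => [|k IH] f; first by split.
move=> [f' ff' f's]; have E : derive1 f = f'.
  by apply/funext => x; exact: is_derive_derive1.
have [fd fk] := IH _ f's; split=> [[|i] ik x|]; last by rewrite derive1Sn E.
  by rewrite derive1n0; have [] := ff' x.
by rewrite derive1Sn E; exact: fd.
Qed.

End SmoothClass.

(** * Maps commuting with integer translations *)

Section Periodic.
Variable R : realType.

Lemma derive1_periodic (f : R -> R) (c : R) :
  (forall x, f (x + 1) = f x + c) -> forall x, derive1 f (x + 1) = derive1 f x.
Proof.
move=> fp x; rewrite /derive1; set u := (X in lim (X @ _)); set v := (X in _ = lim (X @ _)).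
suff -> : u = v by [].
apply/funext => h; rewrite /u /v addrA !fp; congr (_ *: _).
by rewrite opprD addrACA subrr addr0.
Qed.

Lemma derive1n_periodic (f : R -> R) (c : R) k :
  (forall x, f (x + 1) = f x + c) ->
  forall x, derive1n k.+1 f (x + 1) = derive1n k.+1 f x.
Proof.
elim: k f c => [|k IH] f c fp x; first by rewrite derive1n1; exact: derive1_periodic fp x.
rewrite derive1Sn; apply: (IH _ 0) => y; rewrite addr0; exact: derive1_periodic fp y.
Qed.

(** Points at distance at most 1 can be translated into a bounded set; for other
    pairs the oscillation is bounded while |x - y|^gamma is at least 1. *)
Lemma periodic_loc_holder (gamma : R) (f : R -> R) : 0 <= gamma <= 1 ->
  (forall x, f (x + 1) = f x) -> loc_holder gamma f ->
  exists C, forall x y, `|f x - f y| <= C * `|x - y| `^ gamma.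
Proof.
move=> /andP[g0 g1] fp [fc fh]; have [C C0 HC] := fh 2.
have [B HB] := periodic_bounded fc fp.
exists (C + `|B| + `|B|) => x y.
have [xy1|xy1] := leP `|x - y| 1.
  have [m xm] := int_near x.
  rewrite -(periodic_int fp x m) -(periodic_int fp y m).
  have -> : x - y = (x + m%:~R) - (y + m%:~R) by ring.
  apply: le_trans (HC _ _ _ _) _.
  - by rewrite ler_norml; lra.
  - by move: xy1; rewrite !ler_norml; lra.
  - by rewrite ler_wpM2r ?powR_ge0// -addrA lerDl addr_ge0.
have p1 : 1 <= `|x - y| `^ gamma.
  by rewrite -[leLHS](powRr0 `|x - y|); apply: ler_powR => //; exact: ltW.
apply: le_trans (ler_normB _ _) _; apply: (@le_trans _ _ (C + `|B| + `|B|)).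
  rewrite -addrA -[leLHS]add0r lerD//.
  by apply: lerD; apply: le_trans (ler_norm B); exact: HB.
by apply: ler_peMr => //; rewrite !addr_ge0.
Qed.

End Periodic.

Section Translation.
Variable R : realType.
Implicit Types (f : R -> R).

Lemma translate_int f (c : R) : (forall x, f (x + 1) = f x + c) ->
  forall x (m : int), f (x + m%:~R) = f x + m%:~R * c.
Proof.
move=> fc x m; have H y : f (y + 1) - (y + 1) * c = f y - y * c by rewrite fc; ring.
have := @periodic_int _ (fun y => f y - y * c) H x m.
by move=> /(canRL (subrK _)) ->; ring.
Qed.

Lemma lift_surjective f (c : R) : continuous f -> 0 < c ->
  (forall x, f (x + 1) = f x + c) -> forall y, exists x, f x = y.
Proof.
move=> fcont c0 fc y.
pose n := (Num.truncn (`|y - f 0| / c)).+1.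
have nP : `|y - f 0| <= n%:~R * c.
  by rewrite -ler_pdivrMr//; apply/ltW; rewrite /n -pmulrn truncnS_gt.
have [x _ E] : exists2 x, Num.min (- n%:R) n%:R <= x <= Num.max (- n%:R) n%:R & f x = y.
  apply: IVT_between => //.
  have := translate_int fc 0 (- n%:Z); have := translate_int fc 0 n.
  rewrite !add0r mulrNz -pmulrn => -> ->; move: nP; rewrite ler_norml -pmulrn.
  by move=> yn; rewrite ge_min le_max; apply/andP; split; apply/orP; [left|right]; lra.
by exists x.
Qed.

Lemma lift_inverse f (f' : R -> R) (c : R) : (forall x : R, is_derive x 1 f (f' x)) ->
  (forall x, 0 < f' x) -> 0 < c -> (forall x, f (x + 1) = f x + c) ->
  exists g : R -> R, [/\ cancel f g, cancel g f &
    forall y : R, is_derive y 1 g (f' (g y))^-1].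
Proof.
move=> ff' f'0 c0 fc; have fcont := is_derive_continuous ff'.
have finj : injective f.
  move=> x y E; have [z _] := mean_value x y ff'.
  rewrite E subrr => /esym/eqP; rewrite mulf_eq0 gt_eqF//= subr_eq0.
  by move/eqP.
have /choice[g gK] := lift_surjective fcont c0 fc.
have fK : cancel f g by move=> x; apply: finj; rewrite gK.
exists g; split=> // y; rewrite -{1}(gK y).
apply: is_derive_inverse => //; last by rewrite gt_eqF.
- by near=> z; exact: fK.
- by near=> z; exact: fcont.
Unshelve. all: by end_near. Qed.

Lemma continuous_eq0_limit (w : R -> R) (a : R) : continuous w ->
  (forall e, 0 < e -> exists2 y, `|y - a| < e & w y = 0) -> w a = 0.
Proof.
move=> wc H; apply/eqP/negPn/negP => wa0.
have w0 : 0 < `|w a| by rewrite normr_gt0.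
have /cvgrPdist_lt/(_ _ w0) := wc a.
rewrite -nbhs_nbhs_norm => -[e /= e0 He].
have [y ya wy] := H e e0.
have := He y; rewrite /= distrC => /(_ ya).
by rewrite wy subr0 ltxx.
Qed.

End Translation.

Lemma is_derive_iter (R : realType) (F F' : R -> R) n (x : R) :
  (forall x : R, is_derive x 1 F (F' x)) ->
  is_derive x 1 (iter n F) (\prod_(k < n) F' (iter k F x)).
Proof.
move=> FF'; elim: n => [|n IH]; first by rewrite big_ord0; exact: is_derive_id.
rewrite big_ord_recr/= mulrC; exact: is_derive1_comp.
Qed.

(** * A C^1 linearization from constant periodic data *)

Section Rigidity.
Variables (R : realType) (F F' F'' sigma : R -> R) (lambda c : R) (d : int).
Hypothesis FF' : forall x : R, is_derive x 1 F (F' x).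
Hypothesis F'F'' : forall x : R, is_derive x 1 F' (F'' x).
Hypothesis F''c : continuous F''.
Hypothesis F'_gt0 : forall x, 0 < F' x.
Hypothesis d_ge2 : 2 <= d.
Hypothesis Fd : forall x, F (x + 1) = F x + d%:~R.
Hypothesis sigma_cont : continuous sigma.
Hypothesis sigma_per : forall x, sigma (x + 1) = sigma x.
Hypothesis sigma_gt0 : forall x, 0 < sigma x.
Hypothesis lambda_gt1 : 1 < lambda.
Hypothesis F_expand : forall x, lambda * sigma x <= sigma (F x) * F' x.

Let lambda_ge0 : 0 <= lambda.
Proof. exact: le_trans ler01 (ltW lambda_gt1). Qed.

Let D n x := \prod_(k < n) F' (iter k F x).

Let Fn_derive n (x : R) : is_derive x 1 (iter n F) (D n x).
Proof. exact: is_derive_iter. Qed.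

Let D_gt0 n x : 0 < D n x.
Proof. by apply: prodr_gt0 => i _; exact: F'_gt0. Qed.

Let Fn_translate n x (j : int) : iter n F (x + j%:~R) = iter n F x + (d ^+ n * j)%:~R.
Proof.
elim: n => [|n IH]; first by rewrite expr0 mul1r.
by rewrite 2!iterS IH (translate_int Fd) -intrM exprS mulrC mulrA mulrAC.
Qed.

Let F'_per x : F' (x + 1) = F' x.
Proof.
rewrite -(is_derive_derive1 (FF' (x + 1))) -(is_derive_derive1 (FF' x)).
exact: derive1_periodic Fd x.
Qed.

Let D_translate n x (j : int) : D n (x + j%:~R) = D n x.
Proof.
by apply: eq_bigr => k _; rewrite Fn_translate (periodic_int F'_per).
Qed.

(** In the metric sigma each step expands by lambda; since sigma is bounded above
    and away from 0, passing to the Euclidean metric costs only a constant. *)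
Let expansion : exists2 kappa, 0 < kappa & forall n x y,
  kappa * lambda ^+ n * `|x - y| <= `|iter n F x - iter n F y|.
Proof.
have [m m0 Hm] := periodic_lower_bound sigma_cont sigma_per sigma_gt0.
have [M HM] := periodic_bounded sigma_cont sigma_per.
have M0 : 0 < M by apply: lt_le_trans (HM 0); rewrite normr_gt0 gt_eqF.
exists (m / M) => [|n x y]; first exact: divr_gt0.
have DL z : m / M * lambda ^+ n <= D n z.
  have H k : lambda ^+ k * sigma z <= D k z * sigma (iter k F z).
    elim: k => [|k IH]; first by rewrite /D big_ord0 expr0.
    rewrite /D big_ord_recr/= exprS -mulrA.
    apply: (@le_trans _ _ (lambda * (D k z * sigma (iter k F z)))).
      by rewrite ler_wpM2l.
    rewrite mulrCA -mulrA ler_wpM2l//; first exact/ltW/D_gt0.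
    by rewrite mulrC [X in _ <= X]mulrC mulrC; exact: F_expand.
  rewrite mulrAC ler_pdivrMr//; apply: le_trans (_ : D n z * sigma (iter n F z) <= _).
    apply: le_trans (H n); by rewrite mulrC ler_wpM2l// exprn_ge0.
  rewrite ler_wpM2l//; first exact/ltW/D_gt0.
  by apply: le_trans (HM _); exact: ler_norm.
have [z _ ->] := mean_value y x (Fn_derive n).
rewrite normrM ler_wpM2r//; apply: le_trans (DL z) _; exact: ler_norm.
Qed.

Let dn_ge2 n : (2 <= d ^+ n.+1).
Proof.
by rewrite exprS; apply: (le_trans d_ge2); apply: ler_peMr; [|apply: exprn_ege1]; move: d_ge2; lra.
Qed.

(** Points y as below are the lifts of the points of period n + 1 of the circle
    map; they exist because F^(n+1) - id has positive degree d^(n+1) - 1. *)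
Let Fn_fix n (m : int) : exists y, iter n.+1 F y = y + m%:~R.
Proof.
have [||x|y E] := @lift_surjective R (fun x => iter n.+1 F x - x) ((d ^+ n.+1 - 1)%:~R) _ _ _ m%:~R.
- move=> x; apply: cvgB; last exact: cvg_id.
  exact: (is_derive_continuous (Fn_derive n.+1)).
- by rewrite ltr0z; have := dn_ge2 n; lra.
- by rewrite -[1]/(1%:~R) Fn_translate mulr1 intrB; ring.
- by exists y; rewrite -E addrC subrK.
Qed.

Hypothesis periodic_data : forall n y (m : int), (0 < n)%N ->
  iter n F y = y + m%:~R -> D n y = c ^+ n.

Let lambdaVn e : 0 < e -> exists n, lambda^-1 ^+ n < e.
Proof.
move=> e0; have [|n] := @small_geometric R 1 lambda^-1 e _ e0.
  by rewrite invr_ge0 lambda_ge0 invf_lt1// (lt_trans ltr01).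
by rewrite mul1r; exists n.
Qed.

Let d_gt0 : (0 : R) < d%:~R.
Proof. by rewrite ltr0z; apply: lt_le_trans d_ge2. Qed.

(** The periodic data enter only through F' p = c at the fixed point: this makes
    ln c - ln F' vanish there, so that along the orbits of G, which converge to p
    exponentially fast, its values decay geometrically. *)
Let transfer_function : exists2 u : R -> R, continuous u &
  forall x, u (F x) = u x + ln c - ln (F' x).
Proof.
have [G [GK FK GD]] := lift_inverse FF' F'_gt0 d_gt0 Fd.
have [p Fp] := Fn_fix 0 0; rewrite addr0 /= in Fp.
have F'p : F' p = c.
  have := @periodic_data 1 p 0 isT; rewrite addr0 => /(_ Fp).
  by rewrite /D big_ord1.
have [kappa k0 Hk] := expansion.
have GnK n y : iter n F (iter n G y) = y.
  elim: n y => [//|n IH] y; rewrite iterSr [iter n.+1 G y]iterS FK; exact: IH.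
have Fnp n : iter n F p = p by elim: n => [//|n IH]; rewrite iterS IH.
have Gcontr n x : `|iter n G x - p| <= lambda^-1 ^+ n * (`|x - p| / kappa).
  have := Hk n (iter n G x) p; rewrite GnK Fnp => H.
  rewrite mulrA ler_pdivlMr// mulrC exprVn ler_pdivlMl ?exprn_gt0 ?(lt_trans ltr01)//.
  by rewrite mulrA [lambda ^+ n * kappa]mulrC.
have F'c := is_derive_continuous F'F''.
have lnD (x : R) : is_derive x 1 (fun x => ln (F' x)) ((F' x)^-1 * F'' x).
  by have := is_derive1_ln (F'_gt0 x) => ?; exact: is_derive1_comp.
have lnc : continuous (fun x => (F' x)^-1 * F'' x).
  by move=> x; apply: cvgM; [apply: cvgV; [rewrite gt_eqF|exact: F'c]|exact: F''c].
have Gc := is_derive_continuous GD.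
have [|||M|u [uc uE]] := @cocycle_solution R G (fun x => ln c - ln (F' (G x))) 1 lambda^-1.
- exact: Gc.
- move=> x; apply: cvgB; first exact: cvg_cst.
  apply: (@continuous_comp _ _ _ G (fun x => ln (F' x))); first exact: Gc.
  exact: (is_derive_continuous lnD).
- by rewrite invr_ge0 lambda_ge0 invf_lt1// (lt_trans ltr01).
- pose N := `|p| + (M + `|p|) / kappa.
  have [C C0 HC] := C1_locally_lipschitz lnD lnc N.
  exists (C * ((M + `|p|) / kappa)) => k x xM; rewrite expr1n mul1r -F'p.
  have lp n : lambda^-1 ^+ n <= 1.
    rewrite exprn_ile1 ?invr_ge0// invf_le1 ?(lt_trans ltr01)//; exact: ltW.
  have xp : `|x - p| / kappa <= (M + `|p|) / kappa.
    rewrite ler_wpM2r ?invr_ge0 ?(ltW k0)//; apply: le_trans (ler_normB _ _) _.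
    by rewrite lerD2r.
  have Gx := Gcontr k.+1 x.
  have GxN : `|G (iter k G x)| <= N.
    rewrite -(subrK p (G _)) addrC; apply: le_trans (ler_normD _ _) _.
    rewrite lerD2l; apply: le_trans Gx _; apply: le_trans xp.
    by rewrite ler_piMl// mulr_ge0 ?invr_ge0 ?(ltW k0).
  have pN : `|p| <= N.
    rewrite lerDl; apply: le_trans xp; by rewrite mulr_ge0 ?invr_ge0 ?(ltW k0).
  rewrite distrC; apply: le_trans (HC _ _ GxN pN) _.
  rewrite -mulrA ler_wpM2l//; apply: le_trans Gx _.
  rewrite mulrC ler_pM ?mulr_ge0 ?invr_ge0 ?(ltW k0) ?exprn_ge0 ?invr_ge0//.
  by rewrite exprS ler_piMl ?exprn_ge0 ?invr_ge0// -[lambda^-1]expr1.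
exists u => // x; have := uE (F x); rewrite GK mul1r => ->; ring.
Qed.

Section TransferFunction.
Variable u : R -> R.
Hypothesis u_cont : continuous u.
Hypothesis uF : forall x, u (F x) = u x + ln c - ln (F' x).

Let u_iter n x : u (iter n F x) = u x + ln c *+ n - ln (D n x).
Proof.
elim: n => [|n IH]; first by rewrite /D big_ord0 ln1 mulr0n addr0 subr0.
rewrite iterS uF IH /D big_ord_recr/= lnM ?posrE// ?D_gt0// mulrSr; ring.
Qed.

Let c_gt0 : 0 < c.
Proof.
have [p Fp] := Fn_fix 0 0.
by have := periodic_data (ltn0Sn 0) Fp; rewrite expr1 => <-.
Qed.

(** The lifted periodic points y with F^(n+1) y = y + m satisfy u (y + m) = u y
    and tend to p as n grows, because |F^(n+1) y - p| <= |y - p| + |m|. *)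
Let u_fixed_point p (m : int) : F p = p -> u (p + m%:~R) = u p.
Proof.
move=> Fp; apply/eqP; rewrite -subr_eq0; apply/eqP.
apply: (@continuous_eq0_limit R (fun x => u (x + m%:~R) - u x)).
  by move=> x; apply: cvgB; [exact: (continuous_translate u_cont)|exact: u_cont].
move=> e e0; have [kappa k0 Hk] := expansion.
(* chosen so that A |y - p| < |y - p| + |m| forces |y - p| < e *)
pose A := 1 + `|m%:~R : R| / e.
have A0 : 0 < A by rewrite ltr_wpDr ?divr_ge0// ltW.
have [n Hn] := lambdaVn (divr_gt0 k0 A0).
have [y Ey] := Fn_fix n m; exists y.
  have Fnp k : iter k F p = p by elim: k => [//|k IH]; rewrite iterS IH.
  have := Hk n.+1 y p; rewrite Ey Fnp => H.
  have lA : A < kappa * lambda ^+ n.+1.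
    rewrite exprVn ltr_pdivlMr// ltr_pdivrMl ?exprn_gt0 ?(lt_trans ltr01)// in Hn.
    apply: lt_le_trans (_ : _ < lambda ^+ n * kappa) _ => //.
    by rewrite mulrC ler_wpM2l ?(ltW k0)// exprS ler_peMl ?exprn_ge0// ltW.
  have [->|yp] := eqVneq y p; first by rewrite subrr normr0.
  have yp0 : 0 < `|y - p| by rewrite normr_gt0 subr_eq0.
  have : A * `|y - p| < `|y - p| + `|m%:~R : R|.
    apply: lt_le_trans (_ : _ < kappa * lambda ^+ n.+1 * `|y - p|) _.
      by rewrite ltr_pM2r.
    by apply: le_trans H _; rewrite addrAC; exact: ler_normD.
  rewrite /A mulrDl mul1r ltrD2l => H2; apply/negPn/negP; rewrite -leNgt => ey.
  have : `|m%:~R : R| <= `|m%:~R| / e * `|y - p|.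
    by rewrite -mulrA ler_peMr// ler_pdivlMl// mulr1.
  by rewrite leNgt H2.
rewrite -Ey u_iter (periodic_data _ Ey)// lnXn// ; ring.
Qed.

(** The points z with F^n z in p + Z, for some n, are dense, and for these
    the equation transports the identity from p + Z back to z. *)
Let u_periodic x (j : int) : u (x + j%:~R) = u x.
Proof.
have [p Fp] := Fn_fix 0 0; rewrite addr0 /= in Fp.
apply/eqP; rewrite -subr_eq0; apply/eqP.
apply: (@continuous_eq0_limit R (fun x => u (x + j%:~R) - u x)).
  by move=> y; apply: cvgB; [exact: (continuous_translate u_cont)|exact: u_cont].
move=> e e0; have [kappa k0 Hk] := expansion.
have [n Hn] := lambdaVn (mulr_gt0 k0 e0).
pose m := Num.floor (iter n F x - p).
have [|||z Ez] := @lift_surjective R (iter n F) ((d ^+ n)%:~R) _ _ _ (p + m%:~R).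
- exact: is_derive_continuous (Fn_derive n).
- by rewrite ltr0z exprn_gt0// (lt_le_trans _ d_ge2).
- by move=> y; rewrite -[1]/(1%:~R) Fn_translate mulr1.
exists z.
  have := Hk n z x; rewrite Ez => H.
  have H1 : `|p + m%:~R - iter n F x| <= 1.
    have := floor_itv (iter n F x - p); rewrite -/m intrD ler_norml => /andP[]; lra.
  have lp : 0 < lambda ^+ n by rewrite exprn_gt0// (lt_trans ltr01).
  have kl : 1 < kappa * lambda ^+ n * e.
    by move: Hn; rewrite exprVn -[_^-1]mulr1 ltr_pdivrMl// mulrCA mulrA.
  have kl0 : 0 < kappa * lambda ^+ n by rewrite mulr_gt0.
  by rewrite -(ltr_pM2l kl0); apply: le_lt_trans kl; exact: le_trans H1.
have : u (iter n F (z + j%:~R)) = u (iter n F z).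
  by rewrite Fn_translate Ez -addrA -intrD !u_fixed_point.
by rewrite !u_iter D_translate => /addIr/addIr ->; rewrite subrr.
Qed.

(** The chart is the normalized primitive L of exp u.  That c = d is a by-product:
    L (F (p + 1)) = L (p + d) is both c and d times L (p + 1). *)
Lemma linearizing_chart : exists2 phi : R -> R, forall x, phi (x + 1) = phi x + 1 &
  [/\ exists2 phi' : R -> R, forall x : R, is_derive x 1 phi (phi' x) &
        continuous phi' /\ forall x, 0 < phi' x
    & forall x, phi (F x) = d%:~R * phi x].
Proof.
have [p Fp] := Fn_fix 0 0; rewrite addr0 /= in Fp.
have expc : continuous (fun x => expR (u x)).
  by move=> x; apply: continuous_comp; [exact: u_cont|exact: continuous_expR].
have [L0 L0D] := antiderivative expc.
pose L x := L0 x - L0 p.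
have LD (x : R) : is_derive x 1 L (expR (u x)).
  by rewrite -[expR _]subr0; apply: is_deriveB.
have Lp : L p = 0 by rewrite /L subrr.
have LF x : L (F x) = c * L x.
  apply: (@eq_of_derive R (L \o F) (fun x => c * L x) (fun x => c * expR (u x)) p).
  - move=> y; have -> : c * expR (u y) = expR (u (F y)) * F' y.
      by rewrite uF expRB expRD !lnK ?posrE// divfK ?gt_eqF// mulrC.
    exact: is_derive1_comp.
  - by rewrite /= Fp Lp mulr0.
pose a := L (p + 1).
have a0 : 0 < a.
  have [z _] := mean_value p (p + 1) LD.
  by rewrite Lp subr0 -/a addrAC subrr add0r mulr1 => ->; exact: expR_gt0.
have L1 x : L (x + 1) = L x + a.
  apply: (@eq_of_derive R (fun x => L (x + 1)) (fun x => L x + a) (fun x => expR (u x)) p).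
  - by move=> y; rewrite -(u_periodic y 1); exact: is_derive_translate.
  - by move=> y; rewrite -[expR _]addr0; apply: is_deriveD.
  - by rewrite Lp add0r.
have cd : c = d%:~R.
  have := LF (p + 1); rewrite Fd Fp (translate_int L1) Lp add0r L1 Lp add0r.
  by move/(mulIf (negbT (gt_eqF a0)))->.
exists (fun x => L x / a) => [x|]; first by rewrite L1 mulrDl divff ?gt_eqF.
split=> [|x]; last by rewrite LF cd mulrA.
exists (fun x => expR (u x) / a) => [x|].
  exact: is_derive_mulr.
split=> x; last by rewrite divr_gt0 ?expR_gt0.
by apply: cvgM; [exact: expc|exact: cvg_cst].
Qed.

End TransferFunction.

Lemma exists_linearizing_chart : exists2 phi : R -> R, forall x, phi (x + 1) = phi x + 1 &
  [/\ exists2 phi' : R -> R, forall x : R, is_derive x 1 phi (phi' x) &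
        continuous phi' /\ forall x, 0 < phi' x
    & forall x, phi (F x) = d%:~R * phi x].
Proof. by have [u uc uF] := transfer_function; exact: linearizing_chart uc uF. Qed.

End Rigidity.

(** * From C^1 to C^r *)

Section Bootstrap.
Variables (R : realType) (gamma : R).
Hypothesis gamma01 : 0 <= gamma <= 1.

(** Both psi' and phi' are expressed through psi, respectively phi, and functions
    already known to be regular enough, so one derivative is gained at each
    step, until the regularity of F' is exhausted. *)
Lemma smooth_conjugacy k (F F' phi phi' : R -> R) (d : R) : 1 < d ->
  (forall x : R, is_derive x 1 F (F' x)) -> smooth gamma k F' ->
  (forall x, 0 < F' x) ->
  (forall x : R, is_derive x 1 phi (phi' x)) -> continuous phi' ->
  (forall x, 0 < phi' x) ->
  (forall x, phi (x + 1) = phi x + 1) -> (forall x, phi (F x) = d * phi x) ->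
  exists psi, [/\ cancel phi psi, cancel psi phi,
    smooth gamma k.+1 phi & smooth gamma k.+1 psi].
Proof.
move=> d1 FF' F's F'0 phiD phi'c phi'0 phi1 phiF.
have d0 : 0 < d by lra.
have [psi [phiK psiK psiD]] := lift_inverse phiD phi'0 ltr01 phi1.
exists psi; pose psi' y := (phi' (psi y))^-1.
have psic := is_derive_continuous psiD.
have psi'c : continuous psi'.
  move=> y; apply: cvgV; first by rewrite gt_eqF.
  by apply: continuous_comp; [exact: psic|exact: phi'c].
have psi'0 y : 0 < psi' y by rewrite invr_gt0.
have psiE t : psi t = F (psi (t / d)).
  by apply: (can_inj phiK); rewrite phiF !psiK mulrC divfK// gt_eqF.
have psi'E t : psi' t = F' (psi (t / d)) * (psi' (t / d) * d^-1).
  apply: is_derive_unique (psiD t) _.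
  rewrite [X in is_derive _ _ X _](_ : psi = F \o (fun t => psi (t * d^-1))); last exact/funext.
  by apply: is_derive1_comp; exact: is_derive_comp_scale.
have lnpsi'c : continuous (fun t => ln (psi' t)).
  move=> t; apply: (@continuous_comp _ _ _ psi' (@ln R)); first exact: psi'c.
  exact: continuous_ln.
have C1_smooth0 (f f' : R -> R) : (forall x : R, is_derive x 1 f (f' x)) ->
    continuous f' -> smooth gamma 0 f.
  move=> ff' f'c; apply: lipschitz_loc_holder => //.
    exact: is_derive_continuous ff'.
  exact: C1_locally_lipschitz ff' f'c.
have psi's j : (j <= k)%N -> smooth gamma j psi -> smooth gamma j psi'.
  move=> jk psis.
  pose b t := ln (F' (psi (t / d))) + - ln d.
  have bs : smooth gamma j b.
    apply: smoothD; last exact: smooth_cst.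
    apply: smooth_ln => //; apply: (@smooth_scale _ _ gamma01 _ (F' \o psi)).
    by apply: smooth_comp psiD psi'c => //; exact: smooth_le F's.
  have vE t : ln (psi' t) = b t + 1 * ln (psi' (t / d)).
    rewrite psi'E mul1r /b !lnM ?posrE ?invr_gt0 ?mulr_gt0 ?invr_gt0//.
    rewrite lnV ?posrE//; ring.
  have := smooth_scaling_solution gamma01 d1 _ lnpsi'c bs vE.
  rewrite normr1 lexx => /(_ isT) /(smooth_expR gamma01).
  by congr smooth; apply/funext => t; rewrite lnK// posrE.
have psis j : (j <= k.+1)%N -> smooth gamma j psi.
  elim: j => [_|j IH jk]; first exact: C1_smooth0 psiD psi'c.
  by exists psi' => //; apply: psi's => //; apply: IH; exact: ltnW.
have phis j : (j <= k.+1)%N -> smooth gamma j phi.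
  elim: j => [_|j IH jk]; first exact: C1_smooth0 phiD phi'c.
  exists phi' => //.
  have -> : phi' = fun x => (psi' (phi x))^-1.
    by apply/funext => x; rewrite /psi' invrK phiK.
  apply: smooth_inv => //.
  apply: (@smooth_comp _ _ gamma01 _ psi' phi phi') => //.
    by apply: psi's => //; apply: psis; exact: ltnW.
  by apply: IH; exact: ltnW.
by split => //; [exact: phis|exact: psis].
Qed.

Lemma smooth_Cr r (f : R -> R) (c : R) : gamma = r - (Num.truncn r)%:R ->
  1 <= r -> (forall x, f (x + 1) = f x + c) ->
  smooth gamma (Num.truncn r) f -> Cr r f.
Proof.
move=> gE r1 fc /smooth_Ck[fd fh].
split; first by split=> //; case: fh.
rewrite -gE => _; apply: (periodic_loc_holder gamma01) => //.
have : (0 < Num.truncn r)%N by rewrite truncn_gt0.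
by case: (Num.truncn r) => // n _; exact: derive1n_periodic fc.
Qed.

Lemma Cr_smooth r (f : R -> R) : gamma = r - (Num.truncn r)%:R ->
  Cr r f -> smooth gamma (Num.truncn r) f.
Proof.
move=> gE [[fd fc] fh]; apply: Ck_smooth => //.
case: (ltP (Num.truncn r)%:R r) fh => [_ /(_ isT)[C HC]|r0 _]; last first.
  by apply: continuous_loc_holder => //; case/andP: gamma01; lra.
split=> // M; exists `|C| => // x y _ _; rewrite gE.
by apply: le_trans (HC x y) _; rewrite ler_wpM2r ?powR_ge0// ler_norm.
Qed.

End Bootstrap.

(** * Lifts of circle maps *)

Section Circle.
Variable R : realType.
Implicit Types (f g h : circle R -> circle R) (F G H : R -> R).

Lemma circle_piP (x y : R) : circle_pi x = circle_pi y -> exists m : int, x = y + m%:~R.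
Proof.
move/eqP; rewrite circle_pi_eq => /intrP[m E]; exists m.
by rewrite -E addrC subrK.
Qed.

Lemma circle_pi_int (x : R) (m : int) : circle_pi (x + m%:~R) = circle_pi x.
Proof. by apply/eqP; rewrite circle_pi_eq addrAC subrr add0r intr_int. Qed.

Lemma circle_piM (x : R) (m : int) : circle_pi (m%:~R * x) = circle_pi x *~ m.
Proof. by rewrite mulrzl /circle_pi raddfMz. Qed.

Lemma is_lift_comp f g F G : is_lift f F -> is_lift g G -> is_lift (f \o g) (F \o G).
Proof.
move=> [Fc Ff] [Gc Gg]; split=> x /=; last by rewrite Gg Ff.
by apply: continuous_comp; [exact: Gc|exact: Fc].
Qed.

Lemma is_lift_iter f F n : is_lift f F -> is_lift (iter n f) (iter n F).
Proof.
move=> fF; elim: n => [|n IH]; last exact: is_lift_comp fF IH.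
by split=> // x; exact: cvg_id.
Qed.

Lemma is_lift_linear (d : int) : is_lift (@linear_map R d) (fun x => x * d%:~R).
Proof.
split=> [x|x]; last by rewrite mulrC circle_piM.
by apply: cvgM; [exact: cvg_id|exact: cvg_cst].
Qed.

Definition descend F (z : circle R) : circle R := circle_pi (F (circle_repr z)).

Lemma is_lift_descend F : continuous F -> (forall x, F (x + 1) = F x + 1) ->
  is_lift (descend F) F.
Proof.
move=> Fc F1; split=> // x; rewrite /descend.
have [m ->] := circle_piP (circle_reprK (circle_pi x)).
by rewrite (translate_int F1) mulr1 circle_pi_int.
Qed.

Lemma descendK F G : continuous F -> (forall x, F (x + 1) = F x + 1) ->
  continuous G -> (forall x, G (x + 1) = G x + 1) ->
  cancel F G -> cancel (descend F) (descend G).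
Proof.
move=> Fc F1 Gc G1 FK z; rewrite -[z]circle_reprK.
by rewrite (is_lift_descend Fc F1).2 (is_lift_descend Gc G1).2 FK.
Qed.

Lemma degree_lift f F (d : int) : has_degree f d -> is_lift f F ->
  forall x, F (x + 1) = F x + d%:~R.
Proof.
move=> [G fG Gd] fF x; have [m E] := lift_unique fG fF.
by rewrite !E Gd addrAC.
Qed.

Lemma Cr_derive r F : 1 <= r -> Cr r F -> forall x : R, is_derive x 1 F (derive1 F x).
Proof.
move=> r1 [[Fd _] _] x; apply: DeriveDef; last by rewrite derive1E.
by apply: (Fd 0%N); rewrite truncn_gt0.
Qed.

(** * The two implications *)

(** K o H lifts the identity, so it is an integer translation and its derivative
    is 1. *)
Lemma diffeo_lift_derive_neq0 h k H K (x : R) :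
  (forall x : R, is_derive x 1 H (derive1 H x)) ->
  (forall x : R, is_derive x 1 K (derive1 K x)) ->
  is_lift h H -> is_lift k K -> cancel h k -> derive1 H x != 0.
Proof.
move=> HD KD hH kK hk.
have idl : is_lift (k \o h) id by split=> [y|y]; [exact: cvg_id|rewrite /= hk].
have [m E] := lift_unique (is_lift_comp kK hH) idl.
have D1 : is_derive x 1 (K \o H) (derive1 K (H x) * derive1 H x) by exact: is_derive1_comp.
have D2 : is_derive x 1 (K \o H) 1.
  have -> : K \o H = shift (- m%:~R) by apply/funext => y; rewrite /= [y in RHS]E addrK.
  exact: is_derive_shift.
apply/eqP => H0; have := is_derive_unique D1 D2; rewrite H0 mulr0.
by move/eqP; rewrite eq_sym oner_eq0.
Qed.

(** The point x * d^n and x lie over the same point of the circle, since they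
    are mapped by h to the periodic point p; this is why the two values of
    H' agree and cancel. *)
Lemma conjugate_lyapunov (r : R) (d : int) f n p : 1 <= r -> 2 <= d ->
  circle_Cr r f -> Cr_conjugate r f (@linear_map R d) ->
  is_period f n p -> lyapunov f n p = ln d%:~R.
Proof.
move=> r1 d2 [F fF FCr] [h [[H hH HCr] [k [hk kh [K kK KCr]]]] conj] [n0 pn].
have FD := Cr_derive r1 FCr; have HD := Cr_derive r1 HCr; have KD := Cr_derive r1 KCr.
have conjn z : iter n f (h z) = h (iter n (@linear_map R d) z).
  by elim: (n) => [//|i IH] /=; rewrite IH conj.
have iterE (t : R) : iter n (fun x => x * d%:~R) t = t * d%:~R ^+ n.
  by elim: (n) => [|i IH] /=; rewrite ?mulr1// IH exprSr mulrA.
pose x := circle_repr (k p).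
have pE : circle_pi (H x) = p by rewrite -hH.2 circle_reprK kh.
have lin_lift := is_lift_iter n (is_lift_linear d).
have orbit : circle_pi (x * d%:~R ^+ n) = circle_pi x.
  apply: (can_inj hk); rewrite -iterE -lin_lift.2 -conjn hH.2 pE.
  exact: pn.
have [m E] : exists m : int, forall t, (H \o iter n (fun x => x * d%:~R)) t =
    (iter n F \o H) t + m%:~R.
  apply: (@lift_unique _ (iter n f \o h)).
    exact: is_lift_comp (is_lift_iter n fF) hH.
  have -> : iter n f \o h = h \o iter n (@linear_map R d) by apply/funext.
  exact: is_lift_comp hH lin_lift.
have FnD := is_derive_iter n (H x) FD.
have D1 : is_derive x 1 (H \o iter n (fun x => x * d%:~R)) (derive1 H x * d%:~R ^+ n).
  have -> : derive1 H x = derive1 H (x * d%:~R ^+ n).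
    by rewrite -!(Df_lift _ hH) orbit.
  have -> : H \o iter n (fun x => x * d%:~R) = (fun t => H (t * d%:~R ^+ n)).
    by apply/funext => t; rewrite /= iterE.
  exact: is_derive_comp_scale.
have D2 : is_derive x 1 (H \o iter n (fun x => x * d%:~R))
    (derive1 (iter n F) (H x) * derive1 H x).
  have -> : H \o iter n (fun x => x * d%:~R) = (fun t => (iter n F \o H) t + m%:~R).
    exact/funext.
  rewrite -[_ * _]addr0; apply: is_deriveD; apply: is_derive1_comp.
  by rewrite (is_derive_derive1 FnD).
have H0 := diffeo_lift_derive_neq0 x HD KD hH kK hk.
have := is_derive_unique D1 D2; rewrite mulrC => /(mulIf H0) E2.
have d0 : 0 < d%:~R :> R by rewrite ltr0z; apply: lt_le_trans d2.
rewrite /lyapunov -pE (Df_lift _ (is_lift_iter n fF)) -E2.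
have nn0 : n%:R != 0 :> R by rewrite pnatr_eq0 -lt0n.
by rewrite ger0_norm ?exprn_ge0 ?ltW// lnXn// -[ln _ *+ _]mulr_natl mulKf.
Qed.

Lemma constant_lyapunov_conjugate (r : R) (d : int) f : 2 <= r -> 2 <= d ->
  circle_Cr r f -> orientation_preserving f -> expanding f -> has_degree f d ->
  (forall (p q : circle R) (n m : nat),
     is_period f n p -> is_period f m q -> lyapunov f n p = lyapunov f m q) ->
  Cr_conjugate r f (@linear_map R d).
Proof.
move=> r2 d2 [F fF FCr] fo [_ [g [g0 gsm] [lambda l1 fexp]]] fdeg const.
have r1 : 1 <= r by lra.
have Fd := degree_lift fdeg fF.
pose gamma := r - (Num.truncn r)%:R.
have gamma01 : 0 <= gamma <= 1.
  by have := truncn_itv (le_trans ler01 r1); rewrite -natr1 /gamma => /andP[]; lra.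
have FDf x : derive1 F x = Df f (circle_pi x) by rewrite (Df_lift _ fF).
have Fs := Cr_smooth gamma01 (erefl gamma) FCr.
have [k kE] : exists k, Num.truncn r = k.+2.
  have : (1 < Num.truncn r)%N by rewrite truncn_gt_nat.
  by case: (Num.truncn r) => [//|[//|k]] _; exists k.
move: Fs; rewrite kE => -[F' FF' /[dup] F's [F'' F'F'' /smooth_continuous F''c]].
have F'0 x : 0 < F' x by rewrite -(is_derive_derive1 (FF' x)) FDf.
pose sigma x := Num.sqrt (g (circle_pi x)).
have sigma0 x : 0 < sigma x by rewrite sqrtr_gt0.
have sigma_c : continuous sigma.
  move=> x; apply: (@continuous_comp _ _ _ (g \o @circle_pi R) Num.sqrt).
    by have [_] := gsm 0%N; apply.
  exact: sqrt_continuous.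
have sigma_per x : sigma (x + 1) = sigma x.
  by rewrite /sigma -[1]/(1%:~R) circle_pi_int.
have F_expand x : lambda * sigma x <= sigma (F x) * F' x.
  have := fexp (circle_pi x); rewrite fF.2 -FDf (is_derive_derive1 (FF' x)).
  rewrite /metric_norm normr1 mulr1 ltr_pdivlMr ?sigma0// => /ltW.
  by rewrite gtr0_norm.
have [e eP] : exists e, forall n p, is_period f n p -> lyapunov f n p = e.
  have [[n [p np]]|H] := pselect (exists n p, is_period f n p).
    by exists (lyapunov f n p) => m q mq; exact: const.
  by exists 0 => n p np; exfalso; apply: H; exists n, p.
have pdata n y (m : int) : (0 < n)%N -> iter n F y = y + m%:~R ->
    \prod_(i < n) F' (iter i F y) = expR e ^+ n.
  move=> n0 Ey; have lift_n := is_lift_iter n fF.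
  have : is_period f n (circle_pi y) by split=> //; rewrite lift_n.2 Ey circle_pi_int.
  move/eP; rewrite /lyapunov (Df_lift _ lift_n) (is_derive_derive1 (is_derive_iter n y FF')).
  have P0 : 0 < \prod_(i < n) F' (iter i F y) by apply: prodr_gt0.
  have nn0 : n%:R != 0 :> R by rewrite pnatr_eq0 -lt0n.
  rewrite gtr0_norm// => <-; rewrite -expRM_natl mulrA mulfV// mul1r lnK//.
have [phi phi1 [[phi' phiD [phi'c phi'0]] phiF]] := exists_linearizing_chart
  FF' F'F'' F''c F'0 d2 Fd sigma_c sigma_per sigma0 l1 F_expand pdata.
have d1 : 1 < d%:~R :> R by rewrite ltr1z; apply: lt_le_trans d2.
have [psi [phiK psiK phis psis]] := smooth_conjugacy (k := k.+1) gamma01 d1 FF' F's F'0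
  phiD phi'c phi'0 phi1 phiF.
have psi1 x : psi (x + 1) = psi x + 1 by rewrite -{1}(psiK x) -phi1 phiK.
have phic := smooth_continuous phis; have psic := smooth_continuous psis.
rewrite -kE in phis psis.
exists (descend psi).
  split; first by exists psi; [exact: is_lift_descend|exact: (smooth_Cr gamma01 _ r1 psi1)].
  exists (descend phi); split; [exact: descendK|exact: descendK|].
  by exists phi; [exact: is_lift_descend|exact: (smooth_Cr gamma01 _ r1 phi1)].
move=> z; rewrite -[z]circle_reprK /linear_map -circle_piM.
rewrite !(is_lift_descend psic psi1).2 fF.2; congr circle_pi.
by apply: (can_inj phiK); rewrite phiF !psiK.
Qed.

End Circle.

Theorem theorem1p3 (R : realType) (r : R) (d : int) (f : circle R -> circle R)
    (r_ge2 : 2 <= r) (d_ge2 : 2 <= d)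
    (f_Cr : circle_Cr r f)
    (f_orientation : orientation_preserving f)
    (f_expanding : expanding f)
    (f_degree : has_degree f d) :
  Cr_conjugate r f (@linear_map R d) <->
  (forall (p q : circle R) (n m : nat),
     is_period f n p -> is_period f m q -> lyapunov f n p = lyapunov f m q).
Proof.
split=> [conj p q n m np mq|]; last exact: constant_lyapunov_conjugate.
have r1 : 1 <= r by lra.
by rewrite !(conjugate_lyapunov r1 d_ge2 f_Cr conj).
Qed.
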